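(* Let $a_0,a_1\in\mathbb{C}$ be constants, let $v_1,v_2,v_3,v_4$ be analytic functions of $t$ on a domain in $\mathbb{C}\setminus\{1,-2,-\frac12\}$, and let $$A=\begin{pmatrix} z+a_0 & v_1 & v_2 \\ 1 & tz+a_1 & 1 \\ v_3 & v_4 & (-1-t)z-a_0-a_1 \end{pmatrix}.$$ Suppose that $z\frac{d}{dz}+A$ commutes with an operator $\frac{d}{dt}+B_0(t)+zB_1(t)$. Then (with $'=\frac{d}{dt}$) $$v_1'=\frac{-3v_3v_1+3v_2v_4}{2t^2+5t+2},\qquad v_2'=\frac{(6t+3)v_2^2-3v_3(t-1)v_2-3v_1(t+2)+(-9a_0t+9a_1)v_2}{2t^3+3t^2-3t-2},$$ $$v_3'=\frac{(3t-3)v_3^2+(-6t-3)v_2v_3+(9a_0t-9a_1)v_3+3v_4(t+2)}{2t^3+3t^2-3t-2},\qquad v_4'=\frac{3v_3v_1-3v_2v_4}{t^2+t-2}.$$ Moreover the following two expressions are constant (independent of $t$): $$\delta_1=-a_0^2-a_0a_1-a_1^2-v_2v_3-v_1-v_4,$$ $$\delta_0=a_0^2a_1+a_0a_1^2+a_1v_2v_3-a_0v_1+a_0v_4-a_1v_1-v_1v_3-v_2v_4.$$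
   Context: The operators $z\frac{d}{dz}+A$ and $\frac{d}{dt}+B$ commute if and only if $\frac{\partial A}{\partial t}=z\frac{\partial B}{\partial z}+[A,B]$ identically in $z$. This is the family of rank 3 connections with $z=0$ regular singular and eigenvalues $z,tz,(-1-t)z$ at $z=\infty$; $\delta_0,\delta_1$ are the nontrivial coefficients of the characteristic polynomial of the residue matrix $A|_{z=0}$. *)

(* Defs.v *)
From HB Require Import structures.
From mathcomp Require Import all_boot all_order all_algebra.
From mathcomp Require Import all_classical all_reals all_analysis.
From mathcomp.real_closed Require Import complex.

Set Implicit Arguments.
Unset Strict Implicit.
Unset Printing Implicit Defensive.

Import Order.TTheory GRing.Theory Num.Theory.
Import numFieldNormedType.Exports.
Local Open Scope ring_scope.
Local Open Scope classical_set_scope.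

(* R[i], packed as a numFieldType: the topology and the normed-module
   structure of a field over itself are inferred from such a packed structure,
   not from the bare type R[i]. *)
Definition cplx (R : realType) : numFieldType := R[i].

Definition is_domain (R : realType) (U : set (cplx R)) : Prop :=
  [/\ open U, connected U & U !=set0].

(* The scalar field is C, so differentiable is complex (Frechet)
   differentiability; on an open set this is analyticity, in one variable
   (V = C) as well as in two (V = C * C). *)
Definition holomorphic_on (R : realType) (V W : normedModType (cplx R))
  (U : set V) (f : V -> W) : Prop :=
  forall x, U x -> differentiable f x.

(* The operators z d/dz + A and d/dt + B act on vector-valued functions
   F (z, t), where p = (z, t). *)
Definition op_z (R : realType) (A : cplx R -> cplx R -> 'M[cplx R]_3)
    (F : cplx R * cplx R -> 'cV[cplx R]_3) (p : cplx R * cplx R) :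
    'cV[cplx R]_3 :=
  p.1 *: derive1 (fun z => F (z, p.2)) p.1 + A p.1 p.2 *m F p.

Definition op_t (R : realType) (B : cplx R -> cplx R -> 'M[cplx R]_3)
    (F : cplx R * cplx R -> 'cV[cplx R]_3) (p : cplx R * cplx R) :
    'cV[cplx R]_3 :=
  derive1 (fun t => F (p.1, t)) p.2 + B p.1 p.2 *m F p.

(* Equality of the two composites on every F that is jointly holomorphic on
   C x U; for such F the mixed second derivatives agree, so that only the
   zero-order term z dB/dz - dA/dt + [A, B] of the commutator is at stake. *)
Definition operators_commute (R : realType) (U : set (cplx R))
    (A B : cplx R -> cplx R -> 'M[cplx R]_3) : Prop :=
  forall F : cplx R * cplx R -> 'cV[cplx R]_3,
    holomorphic_on ([set: cplx R] `*` U) F ->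
    forall z t : cplx R, U t ->
      op_z A (op_t B F) (z, t) = op_t B (op_z A F) (z, t).

Definition matrix_of_rows (K : nmodType) (s : seq (seq K)) : 'M[K]_3 :=
  \matrix_(i < 3, j < 3) nth 0 (nth [::] s i) j.

Definition connection_matrix (R : realType) (a0 a1 : cplx R)
    (v1 v2 v3 v4 : cplx R -> cplx R) (z t : cplx R) : 'M[cplx R]_3 :=
  matrix_of_rows
    [:: [:: z + a0; v1 t;       v2 t                      ];
        [:: 1;      t * z + a1; 1                         ];
        [:: v3 t;   v4 t;       (- 1 - t) * z - a0 - a1   ] ].

(* Main.v *)
(* Applying both composites to constant vectors gives the zero curvature
   equation dA/dt = z dB/dz + [A, B].  Write A = N + z T with T diagonal, and
   B = B0 + z B1.  The z^2 coefficient says that B1 commutes with T, whose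
   eigenvalues 1, t, -1-t are distinct away from t = 1, -2, -1/2, so B1 is
   diagonal; the z^1 coefficient then gives B1 = diag(0, 1, -1) and the
   off-diagonal entries of B0; the two constant entries 1 in the second row of
   A fix the differences of the diagonal entries of B0, and the remaining
   entries of N' = [N, B0] are the four differential equations.  The two
   invariants have zero derivative, hence are constant on the connected open
   set U. *)
Require Import Defs.
From HB Require Import structures.
From mathcomp Require Import all_boot all_order all_algebra.
From mathcomp Require Import all_classical all_reals all_analysis.
From mathcomp.real_closed Require Import complex.
From mathcomp Require Import ring.

Set Implicit Arguments.
Unset Strict Implicit.
Unset Printing Implicit Defensive.

Import Order.TTheory GRing.Theory Num.Theory.
Import numFieldNormedType.Exports.
Local Open Scope ring_scope.
Local Open Scope classical_set_scope.

(** * Derivatives of vector- and matrix-valued functions *)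

Section Derivatives.
Variable K : numFieldType.

Lemma is_derive_scalel (W : normedModType K) (f : K -> K) (w : W) (x df : K) :
  is_derive x 1 f df -> is_derive x 1 (fun s => f s *: w) (df *: w).
Proof.
move=> [/derivable1_diffP fd <-].
apply: DeriveDef; first exact/diff_derivable/differentiableZl.
rewrite deriveE; last exact: differentiableZl.
by rewrite diffZl // [in RHS]deriveE.
Qed.

Lemma is_derive_mx m n (M : K -> 'M[K]_(m.+1, n.+1)) (x : K)
    (dM : 'M[K]_(m.+1, n.+1)) :
  (forall i j, is_derive x 1 (fun s => M s i j) (dM i j)) ->
  is_derive x 1 M dM.
Proof.
move=> Md.
rewrite (matrix_sum_delta dM).
rewrite (_ : M = \sum_i \sum_j (fun s => M s i j *: delta_mx i j)); last first.
  apply/funext => s; rewrite {1}(matrix_sum_delta (M s)) fct_sumE.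
  by apply: eq_bigr => i _; rewrite fct_sumE.
apply: is_derive_sum => i; apply: is_derive_sum => j.
exact: is_derive_scalel.
Qed.

End Derivatives.

(** * From commuting operators to the zero curvature equation *)

Section ZeroCurvature.
Variable R : realType.
Local Notation C := (cplx R).

Lemma operators_commute_zero_curvature (U : set C) (A B : C -> C -> 'M[C]_3)
    (z t : C) (dA dB : 'M[C]_3) :
  operators_commute U A B -> U t ->
  (forall i j, is_derive t 1 (fun s => A z s i j) (dA i j)) ->
  (forall i j, is_derive z 1 (fun x => B x t i j) (dB i j)) ->
  dA = z *: dB + (A z t *m B z t - B z t *m A z t).
Proof.
move=> AB Ut dAE dBE; apply/matrixP => i j.
(* On a constant basis vector each operator is multiplication by its matrix, so comparing the two
   composites on [e] yields column [j] of the equation. *)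
pose e : 'cV[C]_3 := delta_mx j 0.
have mulE (M : 'M[C]_3) k : (M *m e) k 0 = M k j by rewrite -colE mxE.
have mulderive (M : C -> 'M[C]_3) (dM : 'M[C]_3) (x : C) :
    (forall i j, is_derive x 1 (fun s => M s i j) (dM i j)) ->
    is_derive x 1 (fun s => M s *m e) (dM *m e).
  move=> Md; apply: is_derive_mx => k l; rewrite ord1 mulE.
  by rewrite (_ : (fun s => _) = fun s => M s k j)//; apply/funext => s.
have op0 (D : C -> C -> 'M[C]_3) :
    op_z D (fun=> e) = (fun p => D p.1 p.2 *m e) /\
    op_t D (fun=> e) = (fun p => D p.1 p.2 *m e).
  split; apply/funext => p.
    by rewrite /op_z derive1_cst scaler0 add0r.
  by rewrite /op_t derive1_cst add0r.
have := AB (fun=> e) (fun _ _ => differentiable_cst _ _) z t Ut.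
rewrite (op0 A).1 (op0 B).2 /op_z /op_t /=.
have /@derive_val := mulderive _ _ _ dAE; rewrite -derive1E => ->.
have /@derive_val := mulderive _ _ _ dBE; rewrite -derive1E => ->.
rewrite !mulmxA => E; rewrite -[LHS]mulE -[RHS]mulE; congr ((_ : 'cV_3) _ _).
by rewrite mulmxDl mulmxBl -scalemxAl addrA E addrK.
Qed.

End ZeroCurvature.

(** * Functions with zero complex derivative *)

Section Constancy.
Variable R : realType.
Local Notation C := (cplx R).
Local Notation Re := (@complex.Re R).

(** Taking real parts along a line brings [f] within reach of the real mean value theorem. The real
    difference quotient is bounded by the modulus of the complex one, because |Re w| <= |w|. *)
Lemma is_derive_Re_line (f : C -> C) (p v : C) (s : R) :
  is_derive (p + (s%:C)%C * v : C) 1 f 0 ->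
  is_derive s 1 (fun s : R => Re (f (p + (s%:C)%C * v))) 0.
Proof.
move=> [/derivable1_diffP fd fD].
set q : C := p + _ in fd fD *.
have fv0 : h^-1 *: (f (h *: v + q) - f q) @[h --> (0 : C)^'] --> (0 : C).
  have dv : derivable f q v by exact: diff_derivable.
  have dv0 : 'D_v f q = 0 by rewrite deriveE // diff1E //= derive1E fD scaler0.
  by move: dv; rewrite /derivable -/(derive f q v) dv0.
suff gs : h^-1 *: (Re (f (p + ((h *: 1 + s)%:C)%C * v)) - Re (f q))
    @[h --> (0 : R)^'] --> (0 : R).
  by apply: DeriveDef; [apply/cvg_ex; exists 0 | exact: cvg_lim].
apply/cvgr0Pnorm_lt => e e0.
have eC0 : 0 < (e%:C)%C :> C by rewrite ltcR.
move/cvgr0Pnorm_lt: fv0 => /(_ _ eC0).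
rewrite near_withinE => /nbhs_ballP[d /= d0 dH].
(* A positive element of C is real, so the radius [d] also bounds real increments. *)
have [d' dE] : exists d', d = (d'%:C)%C.
  by have /complex_realP := gtr0_real d0.
have d'0 : 0 < d' by rewrite dE ltcR in d0.
near=> h.
have h0 : h != 0 by near: h; exact: nbhs_dnbhs_neq.
have hd : `|h| < d' by near: h; exact: dnbhs0_lt.
have hCd : ball (0 : C) d (h%:C)%C.
  by rewrite -ball_normE /= sub0r normrN dE normc_def /= expr0n addr0 sqrtr_sqr
    ltcR.
have hC0 : (h%:C)%C != 0 :> C by apply: contra h0 => /eqP/complexI ->.
have := dH _ hCd hC0.
have -> : p + ((h *: 1 + s)%:C)%C * v = (h%:C)%C *: v + q.
  rewrite /q (_ : h *: 1 = h :> R); last exact: mulr1.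
  by rewrite rmorphD mulrDl addrCA.
set w := f _; set w' := f q => H; rewrite -ltcR; apply: le_lt_trans H.
have -> : h^-1 *: (Re w - Re w') = Re ((h%:C)%C^-1 *: (w - w') : C).
  rewrite -(fmorphV (real_complex R)).
  by case: (w) (w') => [a b] [a' b'] /=; rewrite mul0r subr0.
exact: normc_ge_Re.
Unshelve. all: by end_near. Qed.

(** The mean value theorem for Re f on the segment from [x] to [y], which stays in the ball, gives
    equal real parts. The same argument for -i f, whose real part is Im f, gives equal imaginary
    parts. *)
Lemma is_derive0_ball (f : C -> C) (x y : C) (r : C) :
  (forall u, ball x r u -> is_derive u 1 f 0) -> ball x r y -> f y = f x.
Proof.
move=> f0 xy.
have Reconst (k : C -> C) :
    (forall u, ball x r u -> is_derive u 1 k 0) -> Re (k y) = Re (k x).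
  move=> k0; pose g (s : R) := Re (k (x + (s%:C)%C * (y - x))).
  have g0 (s : R) : s \in `[0, 1]%R -> is_derive s 1 g 0.
    rewrite in_itv /= => /andP[s0 s1].
    apply/is_derive_Re_line/k0; move: xy; rewrite -!ball_normE /=.
    apply: le_lt_trans.
    rewrite opprD addNKr normrN normrM (distrC x y) ler_piMl //.
    by rewrite ger0_norm ?lecR // (_ : 1 = (1%:C)%C :> C) // lecR.
  have gc : {within `[0, 1], continuous g}.
    by apply: derivable_within_continuous => s /g0 gs;
      exact: (@ex_derive _ _ _ _ _ _ _ gs).
  have gd (s : R) : s \in `]0, 1[%R -> is_derive s 1 g ((fun=> 0) s).
    by move=> s01; apply: g0; apply: subset_itv_oo_cc.
  have [u _] := MVT_segment ler01 gd gc.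
  rewrite mul0r => /eqP; rewrite subr_eq0 /g => /eqP.
  by rewrite mul0r mul1r addr0 addrC subrK.
have ReE := Reconst f f0.
have : Re ((-'i)%C * f y) = Re ((-'i)%C * f x).
  apply: (Reconst (fun u => (-'i)%C * f u)) => u /f0 fu.
  have := @is_deriveZ _ _ _ f (-'i)%C u 1 0 fu; rewrite scaler0; exact.
move: ReE; case: (f x) (f y) => [a b] [a' b'] /= ->.
by rewrite !mulN1r !oppr0 !mul0r !add0r !opprK => ->.
Qed.

Lemma is_derive0_domain (U : set C) (f : C -> C) :
  open U -> connected U -> U !=set0 -> (forall t, U t -> is_derive t 1 f 0) ->
  exists c, forall t, U t -> f t = c.
Proof.
move=> Uo Uc [x Ux] f0; exists (f x).
(* Since [f] is constant on a ball around each point of [U], any condition on its value is open.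
   Taking for [P] equality with [f x], then its negation, makes the level set both open and closed
   in [U]. *)
have openf P : open [set t | U t /\ P (f t)].
  rewrite openE => t [Ut Pt].
  have /nbhs_ballP[r /= r0 rU] := open_nbhs_nbhs (conj Uo Ut).
  apply/nbhs_ballP; exists r => //= y ty; split; first exact: rU.
  by rewrite (is_derive0_ball _ ty)// => u /rU; exact: f0.
have E : [set t | U t /\ f t = f x] = U.
  apply: Uc; first by exists x.
  - exists [set t | U t /\ f t = f x]; first exact: (openf (fun w => w = f x)).
    by apply/seteqP; split => t /= [].
  - exists (~` [set t | U t /\ f t <> f x]).
      exact/open_closedC/(openf (fun w => w <> f x)).
    apply/seteqP; split => t /= [Ut].
      by move=> ft; split => // -[].
    by move=> /not_andP[//|/contrapT].
by move=> t; rewrite -[in U t]E => -[].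
Qed.

End Constancy.

(** * Comparing coefficients of z and solving the system at a fixed t *)

Lemma quadratic_coef0 (K : numFieldType) (a b c : K) :
  (forall z, a + b * z + c * z ^+ 2 = 0) -> [/\ a = 0, b = 0 & c = 0].
Proof.
move=> E.
have a0 : a = 0 by have := E 0; rewrite mulr0 expr0n mulr0 !addr0.
(* The value at -1 gives c = b, and the value at 1 then gives 2b = 0, where characteristic zero is
   used. *)
have := E 1; have := E (- 1).
rewrite a0 sqrrN expr1n !mulr1 mulrN1 !add0r => /(canRL (addKr _)).
rewrite addr0 opprK => ->.
by move/eqP; rewrite -mulr2n mulrn_eq0 /= => /eqP ->.
Qed.

(** A tool for solving linear equations: once the multiplier [c] is supplied, only an identity for
    [field] remains. *)
Lemma eq_of_multiple (K : pzRingType) (c a b x y : K) :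
  a = b -> x - y = c * (a - b) -> x = y.
Proof. by move=> ->; rewrite subrr mulr0 => /eqP; rewrite subr_eq0 => /eqP. Qed.

Lemma zero_curvature_coef (K : numFieldType) n (D0 D1 N T M0 M1 : 'M[K]_n) :
  (forall z, D0 + z *: D1 =
     z *: M1 + ((N + z *: T) *m (M0 + z *: M1)
                - (M0 + z *: M1) *m (N + z *: T))) ->
  [/\ D0 = N *m M0 - M0 *m N,
      D1 = M1 + (N *m M1 - M1 *m N) + (T *m M0 - M0 *m T)
    & T *m M1 = M1 *m T].
Proof.
move=> E.
(* The coefficients of 1, z, z^2 in left side minus right side; the left side has no z^2 term, hence
   the sign in [c2]. *)
pose c0 := D0 - (N *m M0 - M0 *m N).
pose c1 := D1 - (M1 + (N *m M1 - M1 *m N) + (T *m M0 - M0 *m T)).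
pose c2 := - (T *m M1 - M1 *m T).
have cE i j : [/\ c0 i j = 0, c1 i j = 0 & c2 i j = 0].
  apply: quadratic_coef0 => z.
  have := congr1 (fun M : 'M[K]_n => M i j) (E z).
  rewrite !mulmxDl !mulmxDr -!scalemxAl -!scalemxAr /c0 /c1 /c2 !mxE.
  by move/eqP; rewrite -subr_eq0 => /eqP E0; rewrite -[RHS]E0; ring.
split; apply/eqP; rewrite -subr_eq0; apply/eqP/matrixP => i j;
  have [E0 E1 E2] := cE i j; rewrite [RHS]mxE //.
by apply/eqP; rewrite -oppr_eq0 -E2 !mxE.
Qed.

(** With t fixed, the derivatives are mere scalars [d1], ..., [d4] and everything is algebra over a
    field. The last two equations are the derivatives of delta_1 and delta_0 expanded by the product
    rule. *)
Lemma zero_curvature_system (K : numFieldType) (t a0 a1 u1 u2 u3 u4 : K)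
    (d1 d2 d3 d4 : K) (M0 M1 : 'M[K]_3) :
  t != 1 -> t != - 2 -> t != - (1 / 2) ->
  (forall z,
    let A := matrix_of_rows
      [:: [:: z + a0; u1; u2];
          [:: 1; t * z + a1; 1];
          [:: u3; u4; (- 1 - t) * z - a0 - a1]] in
    matrix_of_rows [:: [:: 0; d1; d2]; [:: 0; z; 0]; [:: d3; d4; - z]] =
    z *: M1 + (A *m (M0 + z *: M1) - (M0 + z *: M1) *m A)) ->
  [/\ d1 = (- 3 * u3 * u1 + 3 * u2 * u4) / (2 * t ^+ 2 + 5 * t + 2),
      d2 = ((6 * t + 3) * u2 ^+ 2 - 3 * u3 * (t - 1) * u2
              - 3 * u1 * (t + 2) + (- 9 * a0 * t + 9 * a1) * u2)
           / (2 * t ^+ 3 + 3 * t ^+ 2 - 3 * t - 2),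
      d3 = ((3 * t - 3) * u3 ^+ 2 + (- 6 * t - 3) * u2 * u3
              + (9 * a0 * t - 9 * a1) * u3 + 3 * u4 * (t + 2))
           / (2 * t ^+ 3 + 3 * t ^+ 2 - 3 * t - 2)
    & d4 = (3 * u3 * u1 - 3 * u2 * u4) / (t ^+ 2 + t - 2)]
  /\ - (u2 * d3 + u3 * d2) - d1 - d4 = 0
  /\ a1 * (u2 * d3 + u3 * d2) - a0 * d1 + a0 * d4 - a1 * d1
       - (u1 * d3 + u3 * d1) - (u2 * d4 + u4 * d2) = 0.
Proof.
move=> t1 t2 t3 E.
pose o0 : 'I_3 := @Ordinal 3 0 isT.
pose o1 : 'I_3 := @Ordinal 3 1 isT.
pose o2 : 'I_3 := @Ordinal 3 2 isT.
have expand (M N : 'M[K]_3) i j :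
    (M *m N) i j = M i o0 * N o0 j + M i o1 * N o1 j + M i o2 * N o2 j.
  rewrite mxE !big_ord_recl big_ord0 addr0 addrA.
  by congr (M i _ * N _ j + M i _ * N _ j + M i _ * N _ j); apply/val_inj.
pose D0 : 'M[K]_3 := matrix_of_rows
  [:: [:: 0; d1; d2]; [:: 0; 0; 0]; [:: d3; d4; 0]].
pose D1 : 'M[K]_3 := matrix_of_rows
  [:: [:: 0; 0; 0]; [:: 0; 1; 0]; [:: 0; 0; - 1]].
pose N : 'M[K]_3 := matrix_of_rows
  [:: [:: a0; u1; u2]; [:: 1; a1; 1]; [:: u3; u4; - a0 - a1]].
pose T : 'M[K]_3 := matrix_of_rows
  [:: [:: 1; 0; 0]; [:: 0; t; 0]; [:: 0; 0; - 1 - t]].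
have [z|E0 E1 E2] := @zero_curvature_coef _ _ D0 D1 N T M0 M1.
  have -> : D0 + z *: D1 =
      matrix_of_rows [:: [:: 0; d1; d2]; [:: 0; z; 0]; [:: d3; d4; - z]].
    by apply/matrixP => -[[|[|[|//]]] ?] [[|[|[|//]]] ?]; rewrite !mxE /=; ring.
  have -> : N + z *: T = matrix_of_rows
      [:: [:: z + a0; u1; u2]; [:: 1; t * z + a1; 1];
          [:: u3; u4; (- 1 - t) * z - a0 - a1]].
    by apply/matrixP => -[[|[|[|//]]] ?] [[|[|[|//]]] ?]; rewrite !mxE /=; ring.
  exact: E.
have e0 i j := congr1 (fun M : 'M[K]_3 => M i j) E0.
have e1 i j := congr1 (fun M : 'M[K]_3 => M i j) E1.
have e2 i j := congr1 (fun M : 'M[K]_3 => M i j) E2.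
have addE (M P : 'M[K]_3) i j : (M + P) i j = M i j + P i j by rewrite mxE.
have oppE (M : 'M[K]_3) i j : (- M) i j = - M i j by rewrite mxE.
(* Up to sign, t - 1, t + 2 and 2t + 1 are the differences of the eigenvalues 1, t, -1-t of [T]. *)
have t1' : t - 1 != 0 by rewrite subr_eq0.
have t2' : t + 2 != 0 by rewrite addr_eq0.
have t3' : 2 * t + 1 != 0.
  apply: contra t3; rewrite addr_eq0 => /eqP tE; apply/eqP.
  by rewrite -[LHS](mulKf (_ : 2 != 0 :> K)) ?pnatr_eq0 // tE; field.
(* Entry (i,j) of the z^2 equation reads (T_i - T_j) M1_ij = 0. *)
move: (e2 o0 o1) (e2 o0 o2) (e2 o1 o0) (e2 o1 o2) (e2 o2 o0) (e2 o2 o1).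
rewrite !expand /T !mxE /= => k01 k02 k10 k12 k20 k21.
have m01 : M1 o0 o1 = 0.
  by apply: (eq_of_multiple (c := - (t - 1)^-1) k01); field.
have m10 : M1 o1 o0 = 0.
  by apply: (eq_of_multiple (c := (t - 1)^-1) k10); field.
have m02 : M1 o0 o2 = 0.
  by apply: (eq_of_multiple (c := (t + 2)^-1) k02); field.
have m20 : M1 o2 o0 = 0.
  by apply: (eq_of_multiple (c := - (t + 2)^-1) k20); field.
have m12 : M1 o1 o2 = 0.
  by apply: (eq_of_multiple (c := (2 * t + 1)^-1) k12); field.
have m21 : M1 o2 o1 = 0.
  by apply: (eq_of_multiple (c := - (2 * t + 1)^-1) k21); field.
(* As [T] and [M1] are diagonal, both commutators have zero diagonal, so [M1] has the diagonal of
   [D1]. *)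
move: (e1 o0 o0) (e1 o1 o1) (e1 o2 o2).
rewrite !(addE, oppE, expand) /D1 /T /N !mxE /= m01 m10 m02 m20 m12 m21.
move=> g00 g11 g22.
have n00 : M1 o0 o0 = 0 by rewrite [RHS]g00; ring.
have n11 : M1 o1 o1 = 1 by rewrite [RHS]g11; ring.
have n22 : M1 o2 o2 = -1 by rewrite [RHS]g22; ring.
(* With M1 = diag(m), the off-diagonal entries read 0 = N_ij (m_j - m_i) + (T_i - T_j) M0_ij. *)
move: (e1 o0 o1) (e1 o0 o2) (e1 o1 o0) (e1 o1 o2) (e1 o2 o0) (e1 o2 o1).
rewrite !(addE, oppE, expand) /D1 /T /N !mxE /= m01 m10 m02 m20 m12 m21.
rewrite n00 n11 n22.
move=> h01 h02 h10 h12 h20 h21.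
have b01 : M0 o0 o1 = u1 / (t - 1).
  by apply: (eq_of_multiple (c := (t - 1)^-1) h01); field.
have b02 : M0 o0 o2 = u2 / (t + 2).
  by apply: (eq_of_multiple (c := - (t + 2)^-1) h02); field.
have b10 : M0 o1 o0 = 1 / (t - 1).
  by apply: (eq_of_multiple (c := - (t - 1)^-1) h10); field.
have b12 : M0 o1 o2 = 2 / (2 * t + 1).
  by apply: (eq_of_multiple (c := - (2 * t + 1)^-1) h12); field.
have b20 : M0 o2 o0 = u3 / (t + 2).
  by apply: (eq_of_multiple (c := (t + 2)^-1) h20); field.
have b21 : M0 o2 o1 = 2 * u4 / (2 * t + 1).
  by apply: (eq_of_multiple (c := (2 * t + 1)^-1) h21); field.
move: (e0 o0 o1) (e0 o0 o2) (e0 o1 o0) (e0 o1 o2) (e0 o2 o0) (e0 o2 o1).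
rewrite !(addE, oppE, expand) /D0 /N !mxE /= b01 b02 b10 b12 b20 b21.
move=> l01 l02 l10 l12 l20 l21.
(* A scalar matrix added to [M0] leaves the commutator unchanged, so only differences of diagonal
   entries can be found; [M0 o0 o0] stays free and cancels in the four equations. *)
have x11 : M0 o1 o1 = M0 o0 o0 + (a1 - a0) / (t - 1) + u3 / (t + 2)
                      - 2 * u3 / (2 * t + 1).
  by apply: (eq_of_multiple (c := 1) l10); field; rewrite t1' t2' t3'.
have x22 : M0 o2 o2 = M0 o1 o1 + u2 / (t - 1)
     - 2 * (2 * a1 + a0) / (2 * t + 1) - u2 / (t + 2).
  by apply: (eq_of_multiple (c := -1) l12); field; rewrite t1' t2' t3'.
rewrite x22 x11 in l01 l02 l20 l21.
(* The stated denominators are products of eigenvalue differences, hence nonzero. *)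
have q1 : 2 * t ^+ 2 + 5 * t + 2 = (2 * t + 1) * (t + 2) by ring.
have q2 : 2 * t ^+ 3 + 3 * t ^+ 2 - 3 * t - 2 =
    (t - 1) * (t + 2) * (2 * t + 1) by ring.
have q3 : t ^+ 2 + t - 2 = (t - 1) * (t + 2) by ring.
rewrite q1 q2 q3 l01 l02 l20 l21.
split; first by split; field; rewrite ?t1' ?t2' ?t3'.
by split; field; rewrite t1' t2' t3'.
Qed.

Lemma is_derive_affine (K : numFieldType) (b c x : K) :
  is_derive x 1 (fun s => s * b + c) b.
Proof.
have := is_deriveD (is_deriveM (is_derive_id x 1) (is_derive_cst b x 1))
  (is_derive_cst c x 1).
by move/is_derive_eq; apply; rewrite scaler0 add0r addr0 [_%:A]mulr1.
Qed.

Theorem mainTheorem8 (R : realType) (U : set (cplx R)) (a0 a1 : cplx R)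
    (v1 v2 v3 v4 : cplx R -> cplx R) (B0 B1 : cplx R -> 'M[cplx R]_3)
    (U_domain : is_domain U)
    (U_avoids : U `<=` ~` [set 1; - 2; - (1 / 2)])
    (v1_hol : holomorphic_on U v1) (v2_hol : holomorphic_on U v2)
    (v3_hol : holomorphic_on U v3) (v4_hol : holomorphic_on U v4)
    (AB_commute : operators_commute U
       (connection_matrix a0 a1 v1 v2 v3 v4)
       (fun z t => B0 t + z *: B1 t)) :
  (forall t, U t ->
    [/\ derive1 v1 t =
          (- 3 * v3 t * v1 t + 3 * v2 t * v4 t) / (2 * t ^+ 2 + 5 * t + 2),
        derive1 v2 t =
          ((6 * t + 3) * v2 t ^+ 2 - 3 * v3 t * (t - 1) * v2 t
             - 3 * v1 t * (t + 2) + (- 9 * a0 * t + 9 * a1) * v2 t)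
          / (2 * t ^+ 3 + 3 * t ^+ 2 - 3 * t - 2),
        derive1 v3 t =
          ((3 * t - 3) * v3 t ^+ 2 + (- 6 * t - 3) * v2 t * v3 t
             + (9 * a0 * t - 9 * a1) * v3 t + 3 * v4 t * (t + 2))
          / (2 * t ^+ 3 + 3 * t ^+ 2 - 3 * t - 2)
      & derive1 v4 t =
          (3 * v3 t * v1 t - 3 * v2 t * v4 t) / (t ^+ 2 + t - 2)])
  /\ (exists delta1 : cplx R, forall t, U t ->
        - a0 ^+ 2 - a0 * a1 - a1 ^+ 2 - v2 t * v3 t - v1 t - v4 t = delta1)
  /\ (exists delta0 : cplx R, forall t, U t ->
        a0 ^+ 2 * a1 + a0 * a1 ^+ 2 + a1 * v2 t * v3 t - a0 * v1 t
          + a0 * v4 t - a1 * v1 t - v1 t * v3 t - v2 t * v4 t = delta0).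
Proof.
case: U_domain => Uopen Uconn Une.
have derivE (v : cplx R -> cplx R) (t : cplx R) :
    holomorphic_on U v -> U t -> is_derive t 1 v (derive1 v t).
  by move=> hv Ut; rewrite derive1E; apply/derivableP/diff_derivable/hv.
have nonsing t : U t -> [/\ t != 1, t != - 2 & t != - (1 / 2)].
  by move=> Ut; split; apply/eqP => tE; have := U_avoids _ Ut; apply;
    rewrite tE /=; [left; left | left; right | right].
have curv t : U t -> forall z,
    matrix_of_rows [:: [:: 0; derive1 v1 t; derive1 v2 t]; [:: 0; z; 0];
                       [:: derive1 v3 t; derive1 v4 t; - z]] =
    z *: B1 t +
      (connection_matrix a0 a1 v1 v2 v3 v4 z t *m (B0 t + z *: B1 t)
       - (B0 t + z *: B1 t) *m connection_matrix a0 a1 v1 v2 v3 v4 z t).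
  move=> Ut z; apply: (operators_commute_zero_curvature AB_commute Ut) => i j.
    (* At fixed z, the last diagonal entry is rearranged as an affine function of [s], to fit
       [is_derive_affine]. *)
    have -> : (fun s => connection_matrix a0 a1 v1 v2 v3 v4 z s i j) =
        (fun s => nth 0 (nth [::] [:: [:: z + a0; v1 s; v2 s];
          [:: 1; s * z + a1; 1];
          [:: v3 s; v4 s; s * - z + (- z - a0 - a1)]] i) j).
      apply/funext => s; rewrite mxE; congr (nth 0 (nth [::] _ i) j).
      by congr [:: _; _; [:: _; _; _]]; ring.
    rewrite mxE; case: i j => [[|[|[|//]]] ?] [[|[|[|//]]] ?] /=;
      by [exact: is_derive_cst | exact: derivE | exact: is_derive_affine].
  have -> : (fun x => (B0 t + x *: B1 t) i j) =
      (fun x => x * B1 t i j + B0 t i j).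
    by apply/funext => x; rewrite !mxE addrC.
  exact: is_derive_affine.
have ODE t (Ut : U t) :=
  let: And3 t1 t2 t3 := nonsing t Ut in
  zero_curvature_system t1 t2 t3 (curv t Ut).
split; first by move=> t /ODE[].
split; apply: (is_derive0_domain Uopen Uconn Une) => t Ut;
  have [_ [I1 I0]] := ODE t Ut;
  have D1 := derivE v1 t v1_hol Ut; have D2 := derivE v2 t v2_hol Ut;
  have D3 := derivE v3 t v3_hol Ut; have D4 := derivE v4 t v4_hol Ut.
  have H := is_deriveB (is_deriveB (is_deriveB
    (is_derive_cst (- a0 ^+ 2 - a0 * a1 - a1 ^+ 2) t 1)
    (is_deriveM D2 D3)) D1) D4.
  apply: (is_derive_eq H).
  by rewrite sub0r; exact: I1.
(* The term a1 v2 v3 is differentiated as (a1 v2) v3, so the result agrees with [I0] only after the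
   ring normalization below. *)
have H := is_deriveB (is_deriveB (is_deriveB (is_deriveD (is_deriveB (is_deriveD
  (is_derive_cst (a0 ^+ 2 * a1 + a0 * a1 ^+ 2) t 1)
  (is_deriveM (is_deriveZ a1 D2) D3)) (is_deriveZ a0 D1)) (is_deriveZ a0 D4))
  (is_deriveZ a1 D1)) (is_deriveM D1 D3)) (is_deriveM D2 D4).
apply: (is_derive_eq H).
apply: etrans I0; rewrite -[(a1 \*: v2) t]/(a1 * v2 t) /GRing.scale /=.
move: (derive1 v1 t) (derive1 v2 t) (derive1 v3 t) (derive1 v4 t).
by move: (v1 t) (v2 t) (v3 t) (v4 t) => u1 u2 u3 u4 d1 d2 d3 d4; ring.
Qed.
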